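(* There exists a totally disconnected separable metrizable space $X$ which is not almost zero-dimensional such that $\dim(X)=\dim(\mathcal{K}(X))=1$.
   Context: All spaces are assumed to be separable and metrizable. A space is zero-dimensional if it has a base of clopen sets. $\dim$ denotes topological dimension of separable metrizable spaces; the paper describes dimension one as follows: $\dim(X)=1$ if and only if $X$ has a base $\beta$ such that the boundary $\mathrm{bd}_X(U)$ is zero-dimensional and nonempty for every $U\in\beta$. A space $(X,\mathcal{T})$ is almost zero-dimensional (AZD) if there is a zero-dimensional topology $\mathcal{W}$ on $X$ which is coarser than $\mathcal{T}$ and such that every point of $X$ has a local neighborhood base (in $\mathcal{T}$) consisting of sets that are closed with respect to $\mathcal{W}$. For a space $X$, $\mathcal{K}(X)$ denotes the hyperspace of nonempty compact subsets of $X$ with the Vietoris topology, whose canonical base consists of the sets $\langle U_1,\ldots,U_n\rangle=\{F\in\mathcal{K}(X): F\subset\bigcup_{k=1}^n U_k,\ F\cap U_k\neq\emptyset\text{ for all }k\le n\}$, where $n\in\mathbb{N}$ and $U_1,\ldots,U_n$ are nonempty open subsets of $X$. *)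

(* Defs.v *)
From HB Require Import structures.
From mathcomp Require Import all_boot all_order all_algebra.
From mathcomp Require Import all_classical all_reals all_analysis.

Set Implicit Arguments.
Unset Strict Implicit.
Unset Printing Implicit Defensive.

Local Open Scope classical_set_scope.

Definition separable (T : topologicalType) : Prop :=
  exists2 D : set T, countable D & dense D.

(* The convention of dimension theory (Engelking): quasi-components, rather
   than components, are singletons. This is the property that the library
   calls [zero_dimensional], and it implies the component-based
   [totally_disconnected] of the library (lemma
   [totally_disconnected_space_component]). *)
Definition totally_disconnected_space (T : topologicalType) : Prop :=
  forall x y : T, x <> y -> exists U : set T, [/\ clopen U, U x & ~ U y].

(* Not the library's [zero_dimensional], which is a weaker property. *)
Definition has_clopen_base (T : topologicalType) : Prop :=
  exists2 B : set_system T, basis B & B `<=` clopen.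

(* [Topological.axioms_ X] is the type of topologies on the carrier [X], and
   [Topological.Pack W] is the space [(X, W)]. No metrizability is required of
   [W], so that failing to be almost zero-dimensional is here formally
   at least as strong as with metrizable witness topologies only. *)
Definition almost_zero_dimensional (X : topologicalType) : Prop :=
  exists W : Topological.axioms_ X,
    let XW : topologicalType := Topological.Pack W in
    [/\ has_clopen_base XW,
        forall A : set X, @open XW A -> @open X A &
        forall (x : X) (U : set X), nbhs x U ->
          exists A : set X, [/\ nbhs x A, @closed XW A & A `<=` U]].

Definition boundary (T : topologicalType) (A : set T) : set T :=
  closure A `\` A°.

(* Small inductive dimension, which agrees with the covering dimension and with
   the large inductive dimension on separable metrizable spaces; the index is
   shifted by one to start from the empty space, of dimension -1. The boundary
   is coerced to the subtype [set_type], with its subspace topology. *)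
Fixpoint dim_lt (n : nat) (T : topologicalType) : Prop :=
  match n with
  | 0 => [set: T] = set0
  | m.+1 => exists2 B : set_system T,
      basis B & forall U, B U -> dim_lt m (boundary U)
  end.

Definition has_dim (n : nat) (T : topologicalType) : Prop :=
  dim_lt n.+1 T /\ ~ dim_lt n T.

Section Vietoris.
Context {X : topologicalType}.

Definition hyperspace : Type := {F : set X | compact F /\ F !=set0}.

HB.instance Definition _ := gen_eqMixin hyperspace.
HB.instance Definition _ := gen_choiceMixin hyperspace.

Definition vietoris_index : set (seq (set X)) :=
  [set s | s <> [::] /\ forall U, U \in s -> open U /\ U !=set0].

Definition vietoris_base (s : seq (set X)) : set hyperspace :=
  [set F | sval F `<=` \bigcup_(U in [set` s]) U /\
           forall U, U \in s -> sval F `&` U !=set0].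

Lemma vietoris_cover : \bigcup_(s in vietoris_index) vietoris_base s = setT.
Proof.
apply/seteqP; split=> // -[F [cF [x Fx]]] _; exists [:: setT].
  split=> // U; rewrite inE => /eqP ->.
  by split; [exact: openT | exists x].
split=> [y Fy|U] /=; first by exists setT => //=; rewrite inE.
by rewrite inE => /eqP ->; exists x.
Qed.

Lemma vietoris_join (s t : seq (set X)) (F : hyperspace) :
  vietoris_index s -> vietoris_index t ->
  vietoris_base s F -> vietoris_base t F ->
  exists r, [/\ vietoris_index r, vietoris_base r F &
                vietoris_base r `<=` vietoris_base s `&` vietoris_base t].
Proof.
move=> [s0 sO] [t0 tO] [sF sFm] [tF tFm].
pose S : set X := \bigcup_(U in [set` s]) U.
pose T : set X := \bigcup_(U in [set` t]) U.
have oS : open S by apply: bigcup_open => U /sO[].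
have oT : open T by apply: bigcup_open => U /tO[].
pose r := [seq U `&` T | U <- s] ++ [seq U `&` S | U <- t].
have rm U : U \in r -> sval F `&` U !=set0 /\ open U.
  rewrite mem_cat => /orP[] /mapP[V Vs ->].
    have [x [Fx Vx]] := sFm V Vs; split; last by apply: openI => //; case: (sO V Vs).
    by exists x; split => //; split => //; exact: tF.
  have [x [Fx Vx]] := tFm V Vs; split; last by apply: openI => //; case: (tO V Vs).
  by exists x; split => //; split => //; exact: sF.
exists r; split.
- split=> [|U /rm[[x [_ Ux]] oU]]; last by split=> //; exists x.
  by rewrite /r; case: (s) s0.
- split=> [x Fx|U /rm[]//].
  have [U Us Ux] := sF x Fx; exists (U `&` T); last by split=> //; exact: tF.
  by rewrite /= mem_cat (map_f (fun U => U `&` T) Us).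
- move=> G [rG rGm].
  have rS U : U \in s -> U `&` T \in r by move=> Us; rewrite mem_cat (map_f (fun U => U `&` T) Us).
  have rT U : U \in t -> U `&` S \in r.
    by move=> Us; rewrite mem_cat (map_f (fun U => U `&` S) Us) orbT.
  split; split.
  + move=> x /rG[U]; rewrite /= mem_cat => /orP[] /mapP[V Vs ->] [Vx Sx] //.
    by exists V.
  + by move=> U /rS/rGm[x [Gx [Ux _]]]; exists x.
  + move=> x /rG[U]; rewrite /= mem_cat => /orP[] /mapP[V Vs ->] [Vx Sx] //.
    by exists V.
  + by move=> U /rT/rGm[x [Gx [Ux _]]]; exists x.
Qed.

#[local] HB.instance Definition _ := isPointed.Build (seq (set X)) [::].

HB.instance Definition _ :=
  isBaseTopological.Build hyperspace vietoris_cover vietoris_join.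

End Vietoris.
Arguments hyperspace X : clear implicits.

Lemma totally_disconnected_space_component (T : topologicalType) :
  totally_disconnected_space T -> totally_disconnected [set: T].
Proof.
move=> tT; apply: zero_dimension_totally_disconnected => x y /eqP.
exact: tT.
Qed.

Lemma dim_lt1P (T : topologicalType) : dim_lt 1 T <-> has_clopen_base T.
Proof.
split=> -[B bB BP]; exists B => // U BU.
  split; first exact: bB.1.
  move=> x clx; have oU : U° = U by apply/interior_id/bB.1.
  rewrite -oU; apply: contrapT => nUx.
  have bx : boundary U x by [].
  have : [set: boundary U] (exist _ x (mem_set bx)) by [].
  by rewrite (BP U BU).
apply/seteqP; split=> // -[x /[dup] /set_mem[clx nx] _] _ /=; case: nx.
have [oU cU] := BP U BU.
by rewrite -/(interior U) ((interior_id U).1 oU); exact: cU.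
Qed.

(* Main.v *)
Require Import Defs.
From HB Require Import structures.
From mathcomp Require Import all_boot all_order all_algebra.
From mathcomp Require Import all_classical all_reals all_analysis.
From mathcomp Require Import lra ring wochoice.
Set Implicit Arguments.
Unset Strict Implicit.
Unset Printing Implicit Defensive.
Import Order.TTheory GRing.Theory Num.Theory.
Import numFieldNormedType.Exports.
Local Open Scope classical_set_scope.
Local Open Scope ring_scope.

(** Let C be the Cantor set of binary sequences. The space X is a set of points
of C x R with pairwise distinct first coordinates, so that cylinders of C
separate its points, and it is built by transfinite recursion so as to satisfy
two properties.

- X meets every closed subset of C x R whose projection to C is uncountable.
- For a compact subset G of X let [height G] be a real number that encodes the
  projection D of G to C, injectively and continuously. Then at most one
  point (z, t) of G has t - [height G] rational.

The first property prevents X from being almost zero-dimensional. If V is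
clopen in X, the common boundary of V and of its complement in C x R is a closed
set that misses X, so it lies over a countable subset of C; every other vertical
line is connected and lies on one side ([clopen_slice]). Hence a clopen set
that misses a neighbourhood of a point (z0, t0) of X contains only countably
many points of X over a neighbourhood of z0. Suppose that (z0, t0) has a
neighbourhood A, bounded in the vertical direction, that is closed for a coarser
zero-dimensional topology. Then countably many clopen sets missing A cover the
points of X over a neighbourhood of z0 that are far from t0 vertically; yet
these are uncountably many, because X has points at all vertical coordinates.
In particular X does not have dimension 0, and neither has its hyperspace, in
which X embeds as the set of singletons.

The second property bounds the dimension of the hyperspace. A compact G
has arbitrarily small neighbourhoods ([strip]) given by finitely many conditions
on D and, over each cylinder of some level, by rational lower and upper bounds
for t - [height G]. At a compact set in the boundary of such a neighbourhood, one
of these rational bounds is attained by t - [height G] at some point. A compact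
set in the boundaries of two neighbourhoods with no rational in common would
thus have two points with t - [height G] rational. So such boundaries are
disjoint, and since the rationals can be chosen outside any finite set, the
boundary of each basic neighbourhood has a clopen base
([dim_lt2_disjoint_boundaries]). Bounds relative to [height G] are what makes
this possible: with constant bounds, the first property would give points of X
at any two prescribed vertical coordinates.

For the construction, well-order the closed sets with uncountable projection
so that each has fewer than continuum many predecessors, and choose in each of
them a point (z, t) such that z avoids, for every point (z', t') chosen before,
z' itself and the countable sets D with t' - [height] rational. There are only
countably many of these D for each (z', t'), because [height] determines D. The
choice is possible because an uncountable projection of a closed set has the
size of the continuum ([perfect_set_property]), and fewer than continuum many
countable sets do not cover the Cantor set ([cantor_not_cover]). It is enough
to avoid the countable D, because the projection of a compact G is countable: the
graph moved up by 1 is a closed set which misses X ([compact_countable]). *)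

(** * Countability and the Cantor set *)

Definition cantor : Type := nat -> bool.

Definition agree (n : nat) (z w : cantor) : Prop :=
  forall i, (i < n)%N -> z i = w i.

Definition cyl (s : seq bool) : set cantor :=
  [set z | forall i, (i < size s)%N -> z i = nth false s i].

Lemma cyl_mkseq (z w : cantor) n : cyl (mkseq z n) w <-> agree n w z.
Proof.
rewrite /cyl /= size_mkseq; split=> h i /[dup] ilt /h ->;
by rewrite nth_mkseq.
Qed.

Lemma agreexx n z : agree n z z. Proof. by []. Qed.

Lemma agree_sym n z w : agree n z w -> agree n w z.
Proof. by move=> zw i /zw. Qed.

Lemma agree_trans n z w v : agree n z w -> agree n w v -> agree n z v.
Proof. by move=> zw wv i ilt; rewrite zw// wv. Qed.

Lemma agreeW m n z w : (m <= n)%N -> agree n z w -> agree m z w.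
Proof. by move=> mn zw i im; apply: zw; exact: leq_trans mn. Qed.

Lemma agree_neq (z w : cantor) : z <> w -> exists n, ~ agree n z w.
Proof.
move=> zw; apply: contrapT => h; apply: zw; apply: funext => i.
apply: contrapT => ne; apply: h; exists i.+1 => /(_ i (ltnSn i)); exact: ne.
Qed.

Lemma subset_countable T (A B : set T) :
  A `<=` B -> countable B -> countable A.
Proof. by move=> AB; apply: sub_countable; exact: subset_card_le. Qed.

Lemma image_countable T U (f : T -> U) (A : set T) :
  countable A -> countable (f @` A).
Proof. by apply: sub_countable; exact: card_image_le. Qed.

Lemma setU_countable T (A B : set T) :
  countable A -> countable B -> countable (A `|` B).
Proof.
move=> cA cB; rewrite -bigcup2E; apply: bigcup_countable => // -[|[|i]] _ //=.
Qed.

(** Fewer than continuum many countable sets do not cover the Cantor set. This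
    is Koenig's diagonal argument, with the Cantor set viewed as the sequences
    of points of itself. *)
Lemma cantor_not_cover (J : Type) (A : set J) (B : J -> set cantor) :
  ~ (exists h : J -> cantor, forall c, exists2 a, A a & h a = c) ->
  (forall a, A a -> countable (B a)) ->
  exists c, forall a, A a -> ~ B a c.
Proof.
move=> nsurj cB.
have [e eP] : {e : J -> nat -> cantor &
    forall a, A a -> forall c, B a c -> exists n, e a n = c}.
  apply: (@choice _ _ (fun a e => A a -> forall c, B a c -> exists n, e n = c)).
  move=> a; have [Aa|] := pselect (A a); last by exists (fun _ _ => false).
  have /countable_injP[f finj] := cB _ Aa.
  have [g gP] : {g : nat -> cantor & forall n,
      (exists2 c, B a c & f c = n) -> B a (g n) /\ f (g n) = n}.
    apply: (@choice _ _ (fun n x =>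
      (exists2 c, B a c & f c = n) -> B a x /\ f x = n)) => n.
    have [[c Bc fc]|no] := pselect (exists2 c, B a c & f c = n).
      by exists c.
    by exists (fun=> false).
  exists g => _ c Bc; exists (f c).
  have [|Bg fg] := gP (f c); first by exists c.
  by apply: finj; rewrite ?inE.
(* [y n] differs from the [n]-th component of the [n]-th element of every
   [B a]. *)
have [y yP] : {y : nat -> cantor & forall n a, A a ->
    (fun i => e a n (pickle (n, i))) <> y n}.
  apply: (@choice _ _ (fun n x => forall a, A a ->
    (fun i => e a n (pickle (n, i))) <> x)) => n; apply: contrapT => no; apply: nsurj.
  exists (fun a i => e a n (pickle (n, i))) => c.
  apply: contrapT => nc; apply: no; exists c => a Aa eac; apply: nc.
  by exists a.
exists (fun m => if (unpickle m : option (nat * nat)) is Some (n, i)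
  then y n i else false) => a Aa Bc.
have [n en] := eP a Aa _ Bc.
by apply: (yP n a Aa); apply: funext => i; rewrite en pickleK.
Qed.

Lemma cantor_uncountable : ~ countable [set: cantor].
Proof.
move=> cT.
have nosurj : ~ (exists h : unit -> cantor, forall c,
    exists2 a, [set: unit] a & h a = c).
  move=> [h hP]; have [[] _ h0] := hP (fun=> true).
  by have [[] _] := hP (fun=> false); rewrite h0 => /(congr1 (@^~ 0%N)).
have [c cP] := cantor_not_cover nosurj (fun _ _ => cT).
by case: (cP tt I).
Qed.

Lemma cantor_inj_uncountable T (f : cantor -> T) (A : set T) :
  injective f -> (forall c, A (f c)) -> ~ countable A.
Proof.
move=> finj fA cA; apply: cantor_uncountable.
have /countable_injP[g ginj] := cA.
apply/countable_injP; exists (g \o f) => c c' _ _ /= /ginj.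
by rewrite !inE => /(_ (fA c) (fA c')); exact: finj.
Qed.

Lemma cyl_uncountable s : ~ countable (cyl s).
Proof.
apply: (@cantor_inj_uncountable _
  (fun c i => if (i < size s)%N then nth false s i else c (i - size s)%N)).
  move=> c c' h; apply: funext => i.
  by have := congr1 (fun f => f (size s + i)%N) h; rewrite ltnNge leq_addr addKn.
by move=> c i /= ->.
Qed.

(** * The perfect set theorem *)

(** Closedness for the product topology, in terms of the boxes that all the
    arguments manipulate. *)
Definition box_closed (R : realType) (K : set (cantor * R)) : Prop :=
  forall p, ~ K p -> exists n e, 0 < e /\
    forall q, K q -> agree n p.1 q.1 -> `|q.2 - p.2| < e -> False.

(** All but countably many points of an uncountable set are condensation points
    of it, so there are two distinct ones. *)
Lemma uncountable_condensation (A : set cantor) m : ~ countable A ->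
  exists z0 z1 : cantor, exists n, [/\ (m <= n)%N,
    ~ agree n z0 z1,
    ~ countable (A `&` agree n z0) & ~ countable (A `&` agree n z1)].
Proof.
move=> Anc; pose D := [set z | A z /\ forall n, ~ countable (A `&` agree n z)].
have ADc : countable (A `\` D).
  apply: (@subset_countable _ _ (\bigcup_(s in [set s | countable (A `&` cyl s)])
    (A `&` cyl s))); last by apply: bigcup_countable => //; exact: countableP.
  move=> z [Az nDz]; apply: contrapT => h; apply: nDz; split=> // n cn.
  apply: h; exists (mkseq z n); last by split=> //; exact/cyl_mkseq.
  apply: subset_countable cn => w [Aw /cyl_mkseq zw]; split=> //.
  exact: agree_sym.
have Dnc : ~ countable D.
  move=> cD; apply: Anc; apply: (subset_countable _ (setU_countable ADc cD)).
  by move=> z Az; have [Dz|Dz] := pselect (D z); [right|left].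
have [z0 Dz0] : D !=set0.
  by apply/set0P/eqP => D0; apply: Dnc; rewrite D0; exact: countable0.
have [z1 [Dz1 z01]] : exists z1, D z1 /\ z0 <> z1.
  apply: contrapT => h; apply: Dnc; apply: (@subset_countable _ _ [set z0]).
    by move=> z Dz; apply: contrapT => ne; apply: h; exists z; split=> // /esym.
  exact: finite_set_countable.
have [n nz] := agree_neq z01.
exists z0, z1, (maxn m n); split; first exact: leq_maxl.
- by move=> /(agreeW (leq_maxr m n)).
- exact: Dz0.2.
- exact: Dz1.2.
Qed.

Section perfect_set_property.
Context {R : realType}.
Context (K : set (cantor * R)) (Kcl : box_closed K).

Let piece (s : seq bool) (a w : R) : set (cantor * R) :=
  [set p | K p /\ cyl s p.1 /\ a <= p.2 <= a + w].

Let big (s : seq bool) (a w : R) := ~ countable (fst @` piece s a w).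

Let split_spec (s : seq bool) (a w : R) (c : bool -> seq bool * R) :=
  (forall b : bool, [/\ (size s < size (c b).1)%N,
    big (c b).1 (c b).2 (w / 2) &
    piece (c b).1 (c b).2 (w / 2) `<=` piece s a w]) /\
  (forall z, cyl (c true).1 z -> cyl (c false).1 z -> False).

(* Two condensation points of the projection give incompatible cylinders, and
   over each one half of the interval still carries uncountably many points. *)
Let split_exists s a w : 0 < w -> big s a w -> exists c, split_spec s a w c.
Proof.
move=> w0 bs.
have [z0 [z1 [n [sn z01 b0 b1]]]] := uncountable_condensation (size s).+1 bs.
have half (z : cantor) : ~ countable (fst @` piece s a w `&` agree n z) ->
    exists a', [/\ cyl s z, big (mkseq z n) a' (w / 2), a <= a' & a' + w / 2 <= a + w].
  move=> unc.
  have sz : cyl s z.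
    have [y [[p [_ [ps _]] <-] zp]] : fst @` piece s a w `&` agree n z !=set0.
      by apply/set0P/eqP => e0; apply: unc; rewrite e0; exact: countable0.
    by move=> i ilt; rewrite zp ?ps// (leq_trans ilt)// ltnW.
  have [bl|bl] := pselect (big (mkseq z n) a (w / 2)).
    by exists a; split=> //; lra.
  exists (a + w / 2); split=> //; try lra.
  move=> br; apply: unc; move/contrapT: bl => bl.
  apply: (subset_countable _ (setU_countable bl br)).
  move=> _ [[p [Kp [ps /andP[ap pa]] <-] zp]].
  have [ple|plt] := leP p.2 (a + w / 2).
    left; exists p => //; split=> //; split; first exact/cyl_mkseq/agree_sym.
    by rewrite ap ple.
  right; exists p => //; split=> //; split; first exact/cyl_mkseq/agree_sym.
  by apply/andP; split; lra.
have [a0 [sz0 B0 l0 r0]] := half _ b0; have [a1 [sz1 B1 l1 r1]] := half _ b1.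
have sub z a' : cyl s z -> a <= a' -> a' + w / 2 <= a + w ->
    piece (mkseq z n) a' (w / 2) `<=` piece s a w.
  move=> sz l r p [Kp [/cyl_mkseq pz /andP[pl pr]]]; split=> //; split.
    by move=> i ilt; rewrite pz ?sz// (leq_trans ilt)// ltnW.
  by apply/andP; split; lra.
exists (fun b : bool => if b then (mkseq z0 n, a0) else (mkseq z1 n, a1)).
split=> [[]|z /= /cyl_mkseq zz0 /cyl_mkseq zz1]; last first.
  by apply: z01; apply: (agree_trans (agree_sym zz0)).
- by split=> //=; [rewrite size_mkseq|exact: sub].
- by split=> //=; [rewrite size_mkseq|exact: sub].
Qed.

(** The perfect set theorem for projections of closed sets. Iterating the
    splitting yields a binary tree of pieces of [K] that shrink to points, which
    lie in [K]; incompatible cylinders make their first coordinates distinct. *)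
Lemma perfect_set_property : ~ countable (fst @` K) ->
  exists phi : cantor -> cantor * R,
    (forall c, K (phi c)) /\ injective (fst \o phi).
Proof.
move=> Knc.
have [N bN] : exists N : nat, big [::] (- N.+1%:R) (2 * N.+1%:R).
  apply: contrapT => h; apply: Knc.
  apply: (@subset_countable _ _
      (\bigcup_N (fst @` piece [::] (- N.+1%:R) (2 * N.+1%:R)))).
    move=> _ [p Kp <-]; exists (Num.bound `|p.2|) => //; exists p => //.
    split=> //; split=> //.
    have := archi_boundP (normr_ge0 p.2); rewrite ltr_norml => /andP[pl pr].
    by rewrite -natr1; apply/andP; split; lra.
  apply: bigcup_countable => // n _; apply: contrapT => nc; apply: h.
  by exists n.
have [ch chP] : {ch : (seq bool * R) * R -> bool -> seq bool * R &
    forall x, 0 < x.2 -> big x.1.1 x.1.2 x.2 -> split_spec x.1.1 x.1.2 x.2 (ch x)}.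
  apply: (@choice _ _ (fun x y =>
    0 < x.2 -> big x.1.1 x.1.2 x.2 -> split_spec x.1.1 x.1.2 x.2 y)) => -[[s a] w] /=.
  have [[w0 bs]|h] := pselect (0 < w /\ big s a w).
    by have [c cP] := split_exists w0 bs; exists c.
  by exists (fun=> (s, a)) => w0 bs; case: h.
pose wd k : R := 2 * N.+1%:R / 2 ^+ k.
have wd_gt0 k : 0 < wd k by rewrite divr_gt0 ?mulr_gt0 ?exprn_gt0.
have wdS k : wd k.+1 = wd k / 2 by rewrite /wd exprSr invfM mulrA.
pose node c := fix node k := if k is k'.+1 then ch (node k', wd k') (c k')
  else ([::], - N.+1%:R).
have node_big c k : big (node c k).1 (node c k).2 (wd k).
  elim: k => [|k IH]; first by rewrite /wd expr0 divr1.
  by rewrite wdS; have [/(_ (c k))[]] := chP (node c k, wd k) (wd_gt0 k) IH.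
have node_size c k : (k <= size (node c k).1)%N.
  elim: k => // k IH; apply: (leq_ltn_trans IH).
  by have [/(_ (c k))[]] := chP (node c k, wd k) (wd_gt0 k) (node_big c k).
have node_sub c j k : (j <= k)%N ->
    piece (node c k).1 (node c k).2 (wd k) `<=` piece (node c j).1 (node c j).2 (wd j).
  elim: k => [|k IH]; first by rewrite leqn0 => /eqP ->.
  rewrite leq_eqVlt => /orP[/eqP ->//|/IH]; apply: subset_trans.
  rewrite wdS.
  by have [/(_ (c k))[]] := chP (node c k, wd k) (wd_gt0 k) (node_big c k).
have [pt ptP] : {pt : cantor -> nat -> cantor * R & forall c k,
    piece (node c k).1 (node c k).2 (wd k) (pt c k)}.
  apply: (@choice _ _ (fun c f => forall k, piece (node c k).1 (node c k).2 (wd k) (f k))).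
  move=> c; suff [f fP] : {f : nat -> cantor * R & forall k,
      piece (node c k).1 (node c k).2 (wd k) (f k)} by exists f.
  apply: (@choice _ _ (fun k x => piece (node c k).1 (node c k).2 (wd k) x)) => k.
  have [_ [p pk _]] : fst @` piece (node c k).1 (node c k).2 (wd k) !=set0.
    apply/set0P/eqP => e0; apply: (@node_big c k); rewrite e0; exact: countable0.
  by exists p.
have ptQ c j k : (j <= k)%N -> piece (node c j).1 (node c j).2 (wd j) (pt c k).
  by move=> jk; apply: (node_sub c _ _ jk).
(* The point of the branch [c]: the points [pt c k] converge to it. *)
pose z c : cantor := fun i => (pt c i.+1).1 i.
have zcyl c k : cyl (node c k).1 (z c).
  move=> i ilt; have [ki|ik] := leqP k i.+1.
    by have [_ [+ _]] := ptQ c _ _ ki; apply.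
  have [_ [/(_ i ilt) <- _]] := ptQ c _ _ (leqnn k).
  have ii : (i < size (node c i.+1).1)%N by exact: node_size.
  have [_ [/(_ i ii) -> _]] := ptQ c _ _ (ltnW ik).
  by have [_ [pi _]] := ptQ c _ _ (leqnn i.+1); rewrite /z pi.
pose t c : R := sup (range (fun k => (node c k).2)).
have ub c j k : (node c j).2 <= (node c k).2 + wd k.
  have [_ [_ /andP[l _]]] := ptQ c _ _ (leq_maxl j k).
  have [_ [_ /andP[_ r]]] := ptQ c _ _ (leq_maxr j k).
  exact: le_trans l r.
have tin c k : (node c k).2 <= t c <= (node c k).2 + wd k.
  apply/andP; split.
    apply: ub_le_sup; last by exists k.
    by exists ((node c 0%N).2 + wd 0%N) => _ [j _ <-].
  by apply: ge_sup; [exists (node c 0%N).2; exists 0%N|move=> _ [j _ <-]].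
exists (fun c => (z c, t c)); split=> [c|c c' /= zz].
  apply: contrapT => /Kcl[n [e [e0 h]]].
  have [m me] : exists m, wd m < e.
    have [m mP] : exists m : nat, 2 * N.+1%:R / e < m%:R.
      by exists (Num.bound (2 * N.+1%:R / e)); apply: archi_boundP;
        rewrite divr_ge0 ?mulr_ge0// ltW.
    exists m; rewrite /wd ltr_pdivrMr ?exprn_gt0// [X in _ < X]mulrC -ltr_pdivrMr//.
    apply: (lt_trans mP); rewrite -natrX ltr_nat; exact: ltn_expl.
  pose k := maxn n m.
  have [Kp [pc /andP[pl pr]]] := ptP c k.
  apply: (h _ Kp).
    move=> i ilt; have ik : (i < size (node c k).1)%N.
      by apply: (leq_trans ilt); apply: (leq_trans (leq_maxl n m)).
    by rewrite /= pc// (zcyl c k).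
  have wk : wd k <= wd m.
    have mk : (m <= k)%N by exact: leq_maxr.
    rewrite -(subnK mk); elim: (k - m)%N => // d IH.
    rewrite addSn wdS; apply: le_trans IH.
    by have := wd_gt0 (d + m)%N; lra.
  have /andP[tl tr] := tin c k.
  by rewrite ltr_norml/=; apply/andP; split; lra.
apply: contrapT => cc'; have [n0 nP] := agree_neq cc'.
have [n nn nmin] : exists2 n, ~ agree n.+1 c c' & agree n c c'.
  elim: n0 nP => [h|n IH]; first by case: h.
  have [an nP|nan _] := pselect (agree n c c'); [by exists n|exact: IH].
have nodeE k : (k <= n)%N -> node c k = node c' k.
  by elim: k => // k IH kn; rewrite /= IH ?(ltnW kn)// (nmin k kn).
have [_ incomp] := chP (node c n, wd n) (wd_gt0 n) (node_big c n).
have cne : c n <> c' n.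
  move=> E; apply: nn => i; rewrite ltnS leq_eqVlt => /orP[/eqP ->//|].
  exact: nmin.
have zt : cyl (ch (node c n, wd n) (c n)).1 (z c) := zcyl c n.+1.
have zf : cyl (ch (node c n, wd n) (c' n)).1 (z c).
  by rewrite (nodeE n (leqnn n)) zz; exact: (zcyl c' n.+1).
by case: (c n) (c' n) cne zt zf => -[] // _ a1 a2; apply: (incomp (z c)).
Qed.

End perfect_set_property.

(** * The Cantor set in the line, and transfinite recursion *)

Lemma pow3_lt (R : realType) (e : R) : 0 < e -> exists n : nat, 3 ^- n < e.
Proof.
move=> e0; have [n ne] : exists n : nat, e^-1 < n%:R.
  by exists (Num.bound e^-1); apply: archi_boundP; rewrite invr_ge0 ltW.
exists n; rewrite invf_plt ?posrE ?exprn_gt0//.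
by apply: (lt_trans ne); rewrite -natrX ltr_nat ltn_expl.
Qed.

Section kappa.
Context {R : realType}.
Implicit Types c d : cantor.

Let psum c n : R := \sum_(i < n) (c i)%:R / 3 ^+ i.+1.

(** The sum of the series of the [c i / 3 ^ i.+1]: the embedding of the Cantor
    set as the middle-thirds set, up to scaling. *)
Definition kappa c : R := sup (range (psum c)).

Let psum_bounds c n m : psum c n <= psum c (n + m) <=
  psum c n + (3 ^- n - 3 ^- (n + m)) / 2.
Proof.
elim: m => [|m /andP[l r]]; first by rewrite addn0 subrr mul0r addr0 lexx.
have e3 : 3 ^- (n + m) = 3 * 3 ^- (n + m).+1 :> R.
  by rewrite exprS invfM mulrA divff ?mul1r.
have e0 : 0 < 3 ^- (n + m).+1 :> R by rewrite invr_gt0 exprn_gt0.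
rewrite addnS {2 3}/psum big_ord_recr /= -/(psum c (n + m)).
have [b0 b1] : 0 <= (c (n + m)%N)%:R :> R /\ (c (n + m)%N)%:R <= 1 :> R.
  by case: (c _).
by apply/andP; split; nra.
Qed.

(** The terms after the first [n] add up to at most half of [3 ^- n], which is
    what makes ternary expansions with digits 0 and 1 unique. *)
Lemma kappa_bounds c n : psum c n <= kappa c <= psum c n + 3 ^- n / 2.
Proof.
have ub k : psum c k <= psum c n + 3 ^- n / 2.
  have p0 j : 0 <= 3 ^- j :> R by rewrite invr_ge0 exprn_ge0.
  have [nk|kn] := leqP n k.
    have /andP[_] := psum_bounds c n (k - n); rewrite subnKC// => h.
    by have := p0 k; have := p0 n; lra.
  have /andP[+ _] := psum_bounds c k (n - k); rewrite subnKC// ?(ltnW kn)// => h.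
  by have := p0 n; lra.
apply/andP; split.
  apply: ub_le_sup; last by exists n.
  by exists (psum c n + 3 ^- n / 2) => _ [k _ <-].
by apply: ge_sup; [exists (psum c 0); exists 0%N|move=> _ [k _ <-]].
Qed.

Lemma kappa_ge0 c : 0 <= kappa c.
Proof. by have := kappa_bounds c 0; rewrite /psum big_ord0 => /andP[]. Qed.

Let psum_agree c d n : agree n c d -> psum c n = psum d n.
Proof. by move=> cd; apply: eq_bigr => i _; rewrite cd. Qed.

Lemma kappa_agree c d n : agree n c d -> `|kappa c - kappa d| < 3 ^- n.
Proof.
move=> /psum_agree cd; have := kappa_bounds c n; have := kappa_bounds d n.
rewrite cd => /andP[? ?] /andP[? ?].
have e0 : 0 < 3 ^- n :> R by rewrite invr_gt0 exprn_gt0.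
by rewrite ltr_norml; apply/andP; split; lra.
Qed.

Lemma agree_kappa c d n : `|kappa c - kappa d| < 3 ^- n / 2 -> agree n c d.
Proof.
elim: n => // n IH.
have e0 : 0 < 3 ^- n.+1 :> R by rewrite invr_gt0 exprn_gt0.
have e3 : 3 ^- n = 3 * 3 ^- n.+1 :> R.
  by rewrite exprS invfM mulrA divff ?mul1r.
move=> small; have cd : agree n c d by apply: IH; lra.
suff E : c n = d n.
  by move=> i; rewrite ltnS leq_eqVlt => /orP[/eqP ->//|/cd].
have := kappa_bounds c n.+1; have := kappa_bounds d n.+1.
rewrite /psum !big_ord_recr /= -/(psum c n) -/(psum d n) (psum_agree cd).
move: small; rewrite ltr_norml => /andP[? ?].
by case: (c n) (d n) => -[] //= /andP[? ?] /andP[? ?]; lra.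
Qed.

Lemma kappa_inj : injective kappa.
Proof.
move=> c d E; apply: contrapT => /agree_neq[n]; apply.
by apply: agree_kappa; rewrite E subrr normr0 divr_gt0 ?invr_gt0 ?exprn_gt0.
Qed.

End kappa.

Lemma wf_minimum (J : Type) (lt : J -> J -> Prop) (P : J -> Prop) :
  well_founded lt -> (exists a, P a) ->
  exists m, P m /\ forall a, lt a m -> ~ P a.
Proof.
move=> wf [a Pa]; apply: contrapT => no.
elim: {a}(wf a) Pa => a _ IH Pa; apply: no; exists a; split=> // b ba Pb.

Qed.

(** Recursion along a well-founded relation where each choice only has to be
    compatible with every earlier one taken separately. *)
Lemma transfinite_choice (J Y : Type) (lt : J -> J -> Prop)
    (good : J -> Y -> Prop) (rel : Y -> Y -> Prop) :
  Y -> well_founded lt ->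
  (forall b (f : J -> Y), exists y, good b y /\ forall a, lt a b -> rel (f a) y) ->
  exists x : J -> Y, forall b, good b (x b) /\ forall a, lt a b -> rel (x a) (x b).
Proof.
move=> y0 wf step.
have [s sP] : {s : J * (J -> Y) -> Y & forall bf,
    good bf.1 (s bf) /\ forall a, lt a bf.1 -> rel (bf.2 a) (s bf)}.
  by apply: (@choice _ _ (fun bf y => good bf.1 y /\
    forall a, lt a bf.1 -> rel (bf.2 a) y)) => -[b f]; exact: (step b f).
pose F b (rec : forall a, lt a b -> Y) : Y := s (b, fun a =>
  match pselect (lt a b) with left h => rec a h | right _ => y0 end).
exists (Fix wf (fun=> Y) F) => b.
rewrite Fix_eq; last first.
  move=> a f g fg; congr (s (a, _)); apply: funext => d.
  by case: pselect => // h; rewrite fg.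
have [gb rb] := sP (b, fun a => match pselect (lt a b) with
  left _ => Fix wf (fun=> Y) F a | right _ => y0 end).
split=> // a ab; move: (rb a ab) => /=.
by case: (pselect (lt a b)).
Qed.

(** An initial ordinal of the continuum: it suffices to cut a well-order of the
    Cantor set at its first element whose predecessors surject onto the Cantor
    set, if there is one. *)
Lemma cantor_indexing : exists (J : Type) (lt : J -> J -> Prop) (code : J -> cantor),
  [/\ well_founded lt, forall a b, a <> b -> lt a b \/ lt b a,
      forall c, exists a, code a = c &
      forall b, ~ (exists h : J -> cantor, forall c, exists2 a, lt a b & h a = c)].
Proof.
have [r wo] := well_ordering_principle (nat -> bool : eqType).
pose lt (a b : cantor) := r a b /\ a <> b.
have minP (P : cantor -> Prop) : (exists a, P a) ->
    exists m, P m /\ forall a, P a -> r m a.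
  move=> [a Pa]; have [|m [[Pm lbm] _]] := wo [pred x : nat -> bool | `[<P x>]].
    by exists a; rewrite inE.
  move: Pm; rewrite inE => Pm; exists m; split=> // b Pb; apply: lbm.
  by rewrite inE.
have anti : antisymmetric r.
  have wc : wo_chain r predT by move=> A _; exact: wo.
  by move=> x y; exact: (wo_chain_antisymmetric wc).
have lt_wf : well_founded lt.
  move=> a; apply: contrapT => nacc.
  have [m [nm lm]] := minP (fun x => ~ Acc lt x) (ex_intro _ a nacc).
  apply: nm; apply: Acc_intro => b [rbm bm]; apply: contrapT => nb.
  by apply: bm; apply: anti; rewrite rbm lm.
have lt_total a b : a <> b -> lt a b \/ lt b a.
  move=> ab; have [m [mab lm]] := minP (fun x => x = a \/ x = b) (ex_intro _ a (or_introl erefl)).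
  case: mab lm => -> lm; [left|right]; split.
  - by apply: lm; right.
  - by [].
  - by apply: lm; left.
  - by move=> /esym.
pose full b := exists h : cantor -> cantor, forall c, exists2 a, lt a b & h a = c.
have [exb|nex] := pselect (exists b, full b); last first.
  exists cantor, lt, id; split=> // [c|b fb]; first by exists c.
  by apply: nex; exists b.
have [b0 [[h hP] b0min]] := wf_minimum lt_wf exb.
exists {a : cantor | lt a b0}, (fun a b => lt (sval a) (sval b)), (h \o sval); split.
- have acc a : Acc lt a -> forall p : {a | lt a b0}, sval p = a ->
      Acc (fun x y => lt (sval x) (sval y)) p.
    elim=> {}a _ IH p pa; apply: Acc_intro => q qp.
    by apply: (IH (sval q)) => //; rewrite -pa.
  by move=> p; exact: (acc _ (lt_wf _) p erefl).
- move=> [a la] [b lb] ab; apply: lt_total => /= E; apply: ab; exact: eq_exist.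
- by move=> c; have [a la <-] := hP c; exists (exist _ a la).
- move=> [b lb] [g gP]; apply: (b0min b lb).
  exists (fun a => match pselect (lt a b0) with
    left l => g (exist _ a l) | right _ => a end) => c.
  have [[a la] /= lab <-] := gP c; exists a => //.
  by case: pselect => // l; congr g; exact: eq_exist.
Qed.

(** * The generic set *)

Section codes.
Context {R : realType}.
Implicit Types (c : cantor) (p : cantor * R).

(** The set of branches of the tree coded by [c]; every closed subset of the
    Cantor set is of this form. *)
Definition body c : set cantor := [set z | forall n, c (pickle (mkseq z n))].

(** The complement of the union of the rational boxes listed by [c]. *)
Definition coded c : set (cantor * R) :=
  [set p | forall (s : seq bool) (q r : rat), c (pickle (s, q, r)) ->
    cyl s p.1 -> ratr q < p.2 < ratr r -> False].

Lemma coded_closed c : box_closed (coded c).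
Proof.
move=> p np; have [s [q [r [csqr sp /andP[qp pr]]]]] :
    exists s (q r : rat), [/\ c (pickle (s, q, r)), cyl s p.1 & ratr q < p.2 < ratr r].
  apply: contrapT => h; apply: np => s q r csqr sp qpr; apply: h.
  by exists s, q, r.
exists (size s), (Num.min (p.2 - ratr q) (ratr r - p.2)); split.
  by rewrite lt_min !subr_gt0 qp.
move=> x cx px; rewrite lt_min !ltr_norml => /andP[/andP[h1 h2] /andP[h3 h4]].
apply: (cx s q r csqr); first by move=> i ilt; rewrite -px// sp.
by apply/andP; split; lra.
Qed.

Lemma codedP (K : set (cantor * R)) : box_closed K -> exists c, coded c = K.
Proof.
move=> Kcl; pose c : cantor := fun m =>
  if (unpickle m : option (seq bool * rat * rat)) is Some (s, q, r)
  then `[< forall p, K p -> cyl s p.1 -> ratr q < p.2 < ratr r -> False >]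
  else false.
exists c; apply/seteqP; split=> p; last first.
  by move=> Kp s q r; rewrite /c pickleK => /asboolP; exact.
move=> cp; apply: contrapT => /Kcl[n [e [e0 ne]]].
have [q] := @rat_in_itvoo R (p.2 - e) p.2 ltac:(lra).
have [r] := @rat_in_itvoo R p.2 (p.2 + e) ltac:(lra).
rewrite !in_itv/= => /andP[pr re] /andP[qe qp].
apply: (cp (mkseq p.1 n) q r); [|exact/cyl_mkseq|by rewrite qp].
rewrite /c pickleK; apply/asboolP => x Kx /cyl_mkseq px /andP[qx xr].
apply: (ne x Kx); first exact: agree_sym.
by rewrite ltr_norml; apply/andP; split; lra.
Qed.

(** What the choice of [p'] after [p] has to avoid. In the second case, [c] codes
    the projection of a potential compact set relative to which [p] has
    rational height, and which could contain [p'] too. *)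
Definition bad p p' : Prop := p'.1 = p.1 \/
  exists (q : rat) c, [/\ p.2 = ratr q + kappa c, countable (body c) & body c p'.1].

(** Given [p], the rational [q] determines the code [c], because [kappa] is
    injective. *)
Lemma bad_countable p : countable [set z | exists t, bad p (z, t)].
Proof.
pose D := [set qc : rat * cantor |
  p.2 = ratr qc.1 + kappa qc.2 /\ countable (body qc.2)].
apply: (@subset_countable _ _ ([set p.1] `|` \bigcup_(qc in D) body qc.2)).
  move=> z [t [zp|[q [c [pq cc bz]]]]]; [by left|right].
  by exists (q, c).
apply: setU_countable; first exact/finite_set_countable/finite_set1.
apply: bigcup_countable => [|qc [_ cc]//].
apply/countable_injP; exists (fun qc => pickle qc.1) => -[q c] [q' c'].
rewrite !inE => -[/= E _] [/= E' _] /(pcan_inj pickleK) qq; rewrite -qq in E' *.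
by congr pair; apply: (@kappa_inj R); apply: (addrI (ratr q)); rewrite -E.
Qed.

(** The transfinite construction, along the codes of closed sets; at a code of a
    closed set with countable projection, any point may be chosen. The last
    property is symmetric in [a] and [b], so it is enough to ensure it for the later of the
    two points. *)
Lemma generic_set : exists (J : Type) (x : J -> cantor * R),
  [/\ injective (fst \o x),
      forall K, box_closed K -> ~ countable (fst @` K) -> exists a, K (x a) &
      forall a b c (q r : rat), a <> b ->
        (x a).2 = ratr q + kappa c -> (x b).2 = ratr r + kappa c ->
        countable (body c) -> body c (x a).1 -> body c (x b).1 -> False].
Proof.
have [J [lt [code [lt_wf lt_total code_surj small]]]] := cantor_indexing.
pose target (b : J) : set (cantor * R) :=
  if pselect (countable (fst @` coded (code b))) then setT else coded (code b).
have targetP b : exists phi : cantor -> cantor * R,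
    (forall c, target b (phi c)) /\ injective (fst \o phi).
  rewrite /target; case: pselect => /= [cc|nc]; last first.
    by have [phi] := perfect_set_property (@coded_closed _) nc; exists phi.
  by exists (fun c => (c, 0)); split=> // c d.
have [|x xP] := @transfinite_choice J (cantor * R)%type lt target
    (fun p p' => ~ bad p p') ((fun=> false), 0) lt_wf.
  move=> b f; have [phi [phiT phi_inj]] := targetP b.
  have [|c cP] := @cantor_not_cover _ [set a | lt a b]
      (fun a => [set d | bad (f a) (phi d)]) (small b).
    move=> a _.
    have /countable_injP[g ginj] := @bad_countable (f a).
    apply/countable_injP; exists (g \o fst \o phi) => d d' bd bd' /= E.
    apply: phi_inj; apply: ginj => //; rewrite inE.
      by exists (phi d).2; rewrite -surjective_pairing; rewrite inE in bd.
    by exists (phi d').2; rewrite -surjective_pairing; rewrite inE in bd'.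
  by exists (phi c); split.
exists J, x; split.
- move=> a b /= E; apply: contrapT => /lt_total[ab|ba].
    by apply: ((xP b).2 a ab); left.
  by apply: ((xP a).2 b ba); left.
- move=> K /codedP[c <-] nc; have [a ac] := code_surj c.
  exists a; have := (xP a).1; rewrite /target ac.
  by case: pselect.
- move=> a b c q r ab Ea Eb cc ba bb; case: (lt_total _ _ ab) => [ltab|ltba].
    by apply: ((xP b).2 a ltab); right; exists q, c.
  by apply: ((xP a).2 b ltba); right; exists r, c.
Qed.

End codes.

(** * The topology of the space *)

(** On the boundary of a basic open set [U], the traces of the basic open sets [V]
    whose boundaries are disjoint from that of [U] are clopen. *)
Lemma dim_lt2_disjoint_boundaries (T : topologicalType) (B : set_system T) :
  B `<=` open ->
  (forall p O, nbhs p O -> exists V, [/\ B V, V p & V `<=` O]) ->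
  (forall U p O, B U -> nbhs p O -> exists V, [/\ B V, V p, V `<=` O &
     boundary V `&` boundary U = set0]) ->
  dim_lt 2 T.
Proof.
move=> Bo Bb Bsep; exists B.
  split=> // p O pO; have [V [BV Vp VO]] := Bb p O pO.
  by exists V.
move=> U BU; apply/dim_lt1P.
exists [set W | exists V, [/\ B V, boundary V `&` boundary U = set0 &
  W = val @^-1` V]] => [|W [V [BV VU ->]]].
  split.
    by move=> W [V [BV _ ->]]; apply: open_comp (Bo V BV) => p _; exact: initial_continuous.
  move=> p O [_ [[A oA <-] Ap AO]].
  have [V [BV Vp VA VU]] := Bsep U (val p) A BU (open_nbhs_nbhs (conj oA Ap)).
  exists (val @^-1` V); last by move=> w Vw; apply: AO; exact: VA.
  by split=> //; exists V.
split; first by apply: open_comp (Bo V BV) => p _; exact: initial_continuous.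
have -> : val @^-1` V = val @^-1` closure V :> set (boundary U).
  apply/seteqP; split=> p Vp; first exact: subset_closure.
  apply: contrapT => nVp; have : (boundary V `&` boundary U) (val p).
    split; last exact: set_valP.
    by split=> // /interior_subset.
  by rewrite VU.
apply: closed_comp (@closed_closure _ V) => p _; exact: initial_continuous.
Qed.

(** The set of the points [x a] with the topology of the product of the Cantor
    set and the line. The injectivity proof is a parameter of the type because it
    makes [graph_dist] a distance. *)
Definition graph_space (R : realType) (J : Type) (x : J -> cantor * R)
  (xinj : injective (fst \o x)) : Type := J.

Section graph_metric.
Context {R : realType} {J : Type} (x : J -> cantor * R).
Context (xinj : injective (fst \o x)).
Local Notation X := (graph_space xinj).

HB.instance Definition _ := gen_eqMixin X.
HB.instance Definition _ := gen_choiceMixin X.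

Definition graph_dist (a b : X) : R :=
  `|kappa (x a).1 - kappa (x b).1| + `|(x a).2 - (x b).2|.

Let graph_distxx a : graph_dist a a = 0.
Proof. by rewrite /graph_dist !subrr normr0 addr0. Qed.

Let graph_dist_eq0 a b : graph_dist a b = 0 -> a = b.
Proof.
move/eqP; rewrite paddr_eq0// !normr_eq0 subr_eq0 => /andP[/eqP/kappa_inj ab _].
exact: xinj.
Qed.

Let graph_distC a b : graph_dist a b = graph_dist b a.
Proof. by rewrite /graph_dist distrC [X in _ + X]distrC. Qed.

Let graph_dist_triangle b a c :
  graph_dist a c <= graph_dist a b + graph_dist b c.
Proof. by rewrite /graph_dist addrACA lerD// ler_distD. Qed.

HB.instance Definition _ := isMetric.Build R X
  graph_distxx graph_dist_eq0 graph_distC graph_dist_triangle.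

End graph_metric.

Section graph_space_theory.
Context {R : realType} {J : Type} (x : J -> cantor * R).
Context (xinj : injective (fst \o x)).
Local Notation X := (graph_space xinj).
Implicit Types a b : X.

Definition box a n (e : R) : set X :=
  [set b | agree n (x a).1 (x b).1 /\ `|(x b).2 - (x a).2| < e].

Lemma nbhs_boxP a A : nbhs a A <-> exists n e, 0 < e /\ box a n e `<=` A.
Proof.
split=> [/nbhs_ballP[e /= e0 eA]|[n [e [e0 eA]]]].
  have e20 : 0 < e / 2 by rewrite divr_gt0.
  have [n ne] := pow3_lt e20; exists n, (e / 2); split=> // b [ab abe].
  apply: eA; rewrite ballEmdist /mdist/= /graph_dist.
  by rewrite (distrC (x a).2); have := @kappa_agree R _ _ _ ab; lra.
apply/nbhs_ballP; exists (Num.min e (3 ^- n / 2)) => /=.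
  by rewrite lt_min e0 divr_gt0// invr_gt0 exprn_gt0.
move=> b; rewrite ballEmdist /mdist/= lt_min /graph_dist => /andP[h1 h2].
have k0 := normr_ge0 (kappa (x a).1 - kappa (x b).1 : R).
have t0 := normr_ge0 ((x a).2 - (x b).2).
apply: eA; split; first by apply: (@agree_kappa R); lra.
by rewrite distrC; lra.
Qed.

End graph_space_theory.

Section graph_space_topology.
Context {R : realType} {J : Type} (x : J -> cantor * R).
Context (xinj : injective (fst \o x)).
Context (x_meets : forall K, box_closed K -> ~ countable (fst @` K) ->
  exists a, K (x a)).
Local Notation X := (graph_space xinj).
Implicit Types a b : X.

Lemma box_center a n (e : R) : 0 < e -> box a n e a.
Proof. by move=> e0; split=> //; rewrite subrr normr0. Qed.

Lemma open_boxP (A : set X) :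
  open A <-> forall a, A a -> exists n e, 0 < e /\ box a n e `<=` A.
Proof.
split=> [oA a Aa|h]; first by apply/nbhs_boxP; exact: open_nbhs_nbhs.
by rewrite openE => a /h/nbhs_boxP.
Qed.

Lemma box_open a n (e : R) : open (box a n e).
Proof.
apply/open_boxP => b [ab abe]; exists n, (e - `|(x b).2 - (x a).2|).
rewrite subr_gt0; split=> // c [bc bce]; split; first exact: agree_trans ab bc.
by have := ler_distD (x b).2 (x c).2 (x a).2; lra.
Qed.

Lemma clopen_cylinder n (w : cantor) : clopen [set a : X | agree n w (x a).1].
Proof.
have op (Q : Prop -> Prop) : open [set a : X | Q (agree n w (x a).1)].
  apply/open_boxP => a Qa; exists n, 1; split=> // b [ab _] /=.
  suff -> : agree n w (x b).1 = agree n w (x a).1 by [].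
  by apply/propext; split=> h; apply: (agree_trans h) => //; exact: agree_sym.
split; first exact: (op id).
by rewrite -openC; exact: (op not).
Qed.

Lemma graph_space_totally_disconnected : totally_disconnected_space X.
Proof.
move=> a b ab; have [n nab] : exists n, ~ agree n (x a).1 (x b).1.
  by apply: agree_neq => /xinj.
by exists [set c : X | agree n (x a).1 (x c).1]; split=> //; exact: clopen_cylinder.
Qed.

(** Horizontal slices of cylinders are closed with uncountable projection. *)
Lemma point_on_slice n (w : cantor) (t : R) :
  exists a, agree n w (x a).1 /\ (x a).2 = t.
Proof.
apply: (@x_meets [set p | agree n w p.1 /\ p.2 = t]).
  move=> p np; have [wp|nwp] := pselect (agree n w p.1).
    exists 0%N, `|t - p.2|; rewrite normr_gt0 subr_eq0; split.
      by apply/eqP => tp; apply: np.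
    by move=> q [_ ->] _; rewrite ltxx.
  exists n, 1; split=> // q [wq _] pq _; apply: nwp.
  by apply: agree_trans wq _; exact: agree_sym.
apply: contra_not (@cyl_uncountable (mkseq w n)); apply: subset_countable.
by move=> v /cyl_mkseq vw; exists (v, t) => //; split=> //; exact: agree_sym.
Qed.

Lemma graph_space_separable : separable X.
Proof.
have [pt ptP] : {pt : seq bool * rat -> X & forall sq,
    agree (size sq.1) (nth false sq.1) (x (pt sq)).1 /\ (x (pt sq)).2 = ratr sq.2}.
  apply: (@choice _ _ (fun sq a => agree (size sq.1) (nth false sq.1) (x a).1 /\
    (x a).2 = ratr sq.2)) => sq; exact: point_on_slice.
exists (range pt); first exact: image_countable.
move=> O [a Oa] /open_boxP /(_ a Oa)[n [e [e0 aO]]].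
have [q] := @rat_in_itvoo R (x a).2 ((x a).2 + e) ltac:(lra).
rewrite in_itv/= => /andP[aq qa]; exists (pt (mkseq (x a).1 n, q)).
split; last by exists (mkseq (x a).1 n, q).
have [/= pz pt2] := ptP (mkseq (x a).1 n, q); apply: aO; split.
  by move=> i ilt; rewrite -pz ?nth_mkseq ?size_mkseq.
by rewrite pt2 ltr_norml; apply/andP; split; lra.
Qed.

Let meets (V : set X) (w : cantor) (t : R) n (e : R) :=
  exists2 b, V b & agree n w (x b).1 /\ `|(x b).2 - t| < e.

(** The boundary [K] of [V] in the product misses the space, so its projection is
    countable. A vertical line that avoids [K] is on one side of [V] by
    connectedness; over the cylinder of [w0] this side is not [V], because [V]
    misses a box there. So [V] has points only over the projection of [K]. *)
Lemma clopen_slice (V : set X) m (w0 : cantor) (t0 d : R) : clopen V -> 0 < d ->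
  (forall b, V b -> agree m w0 (x b).1 -> `|(x b).2 - t0| < d -> False) ->
  countable [set b | V b /\ agree m w0 (x b).1].
Proof.
move=> cV d0 Vmiss.
pose K : set (cantor * R) := [set p | forall n e, 0 < e ->
  meets V p.1 p.2 n e /\ meets (~` V) p.1 p.2 n e].
have Kcl : box_closed K.
  move=> p np; apply: contrapT => h; apply: np => n e e0.
  have [q [Kq pq qe]] : exists q, [/\ K q, agree n p.1 q.1 & `|q.2 - p.2| < e / 2].
    apply: contrapT => no; apply: h; exists n, (e / 2); split; first by rewrite divr_gt0.
    by move=> q Kq pq qe; apply: no; exists q.
  have e20 : 0 < e / 2 by rewrite divr_gt0.
  have tr A : meets A q.1 q.2 n (e / 2) -> meets A p.1 p.2 n e.
    move=> [b Ab [qb be]]; exists b => //; split; first exact: agree_trans pq qb.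
    by have := ler_distD q.2 (x b).2 p.2; lra.
  by have [/tr ? /tr ?] := Kq n _ e20.
have KX a : ~ K (x a).
  have op A : open A -> A a -> exists n e, 0 < e /\ ~ meets (~` A) (x a).1 (x a).2 n e.
    move=> /open_boxP h /h[n [e [e0 eA]]]; exists n, e; split=> // -[b nAb [ab be]].
    by apply: nAb; apply: eA.
  have [Va|nVa] := pselect (V a) => Ka.
    by have [n [e [e0]]] := op V cV.1 Va; apply; exact: (Ka n e e0).2.
  have oV : open (~` V) by rewrite openC; exact: cV.2.
  by have [n [e [e0]]] := op _ oV nVa; rewrite setCK; apply; exact: (Ka n e e0).1.
have cK : countable (fst @` K).
  by apply: contrapT => /(x_meets Kcl)[a]; exact: KX.
have /countable_injP[f finj] : countable (fst @` K) by [].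
suff sub b : V b -> agree m w0 (x b).1 -> (fst @` K) (x b).1.
  apply/countable_injP; exists (f \o fst \o x) => b c.
  rewrite !inE => -[Vb wb] [Vc wc] /= /finj; rewrite !inE => E.
  by apply: xinj; apply: E; apply: sub.
move=> Vb wb; apply: contrapT => nK; set w := (x b).1 in wb nK *.
(* The vertical line over [w] is the disjoint union of the open sets [off V]
   and [off (~` V)]. *)
pose off A := [set t : R | exists n e, 0 < e /\ ~ meets A w t n e].
have off_open A : open (off A).
  rewrite openE => t [n [e [e0 nm]]]; apply/nbhs_ballP; exists (e / 2) => /=.
    by rewrite divr_gt0.
  move=> s; rewrite /ball/= => ts; exists n, (e / 2); split; first by rewrite divr_gt0.
  move=> [c Ac [wc cs]]; apply: nm; exists c => //; split=> //.
  by have := ler_distD s (x c).2 t; rewrite (distrC s t); lra.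
have cover t : off V t \/ off (~` V) t.
  apply: contrapT => /not_orP[n1 n2]; apply: nK; exists (w, t) => // n e e0 /=.
  by split; apply: contrapT => h; [apply: n1|apply: n2]; exists n, e.
have disj t : off V t -> off (~` V) t -> False.
  move=> [n [e [e0 h]]] [n' [e' [e'0 h']]].
  have [c [wc ct]] := point_on_slice (maxn n n') w t.
  have [Vc|nVc] := pselect (V c).
    apply: h; exists c => //; rewrite ct subrr normr0; split=> //.
    exact: agreeW (leq_maxl _ _) wc.
  apply: h'; exists c => //; rewrite ct subrr normr0; split=> //.
  exact: agreeW (leq_maxr _ _) wc.
have all_off : off V = setT.
  have cT : connected [set: R] by apply/connected_intervalP => ? ? ? ? ?.
  apply: cT.
  - exists t0; exists m, d; split=> // -[c Vc [wc ct]].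
    by apply: (Vmiss c Vc) => //; apply: agree_trans wb wc.
  - by exists (off V); rewrite ?setTI.
  - exists (~` off (~` V)); first by rewrite closedC.
    rewrite setTI; apply/seteqP; split=> t; first by move=> o o'; exact: (disj t).
    by case: (cover t).
have : off V (x b).2 by rewrite all_off.
move=> [n [e [e0]]]; apply; exists b => //; split=> //.
by rewrite subrr normr0.
Qed.

End graph_space_topology.

(** * Failure of almost zero-dimensionality *)

(** The topology itself is a witness. *)
Lemma clopen_base_almost_zero_dimensional (T : topologicalType) :
  has_clopen_base T -> almost_zero_dimensional T.
Proof.
move=> [B bB Bc]; exists (Topological.class T) => XW; split=> //.
  by exists B.
move=> p U /(bB.2 p)[V [BV Vp] VU]; exists V; split=> //; last exact: (Bc _ BV).2.
by apply: open_nbhs_nbhs; split=> //; exact: bB.1.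
Qed.

Section not_almost_zero_dimensional.
Context {R : realType} {J : Type} (x : J -> cantor * R).
Context (xinj : injective (fst \o x)).
Context (x_meets : forall K, box_closed K -> ~ countable (fst @` K) ->
  exists a, K (x a)).
Local Notation X := (graph_space xinj).

(** A closed neighbourhood [A] of [x a0] for the coarser topology has a
    complement which is a union of clopen sets. Each of them has countably many
    points over a cylinder around [x a0], hence so does the set [S] by second
    countability; but [S] has a point at every vertical coordinate far from
    that of [x a0]. *)
Lemma graph_space_not_almost_zero_dimensional : ~ almost_zero_dimensional X.
Proof.
move=> [W [[B bB Bc] Wcoarse Wnbhs]].
have [a0 _] := point_on_slice xinj x_meets 0 (fun=> false) 0.
have [|A [nA cA AU]] := Wnbhs a0 (box (xinj := xinj) a0 0 1).
  by apply/nbhs_boxP; exists 0%N, 1; split=> //; exact: ltr01.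
have /nbhs_boxP[m [d [d0 dA]]] := nA.
pose S := [set b : X | agree m (x a0).1 (x b).1 /\ 1 <= `|(x b).2 - (x a0).2|].
pose rbox (sqr : seq bool * rat * rat) := [set b : X | cyl sqr.1.1 (x b).1 /\
  ratr sqr.1.2 < (x b).2 < ratr sqr.2].
have Sc : countable S.
  apply: (@subset_countable _ _
    (\bigcup_(i in [set i | countable (S `&` rbox i)]) (S `&` rbox i))); last first.
    by apply: bigcup_countable => //; exact: countableP.
  move=> y Sy; have nAy : ~ A y.
    by move=> /AU[_]; case: Sy => _; rewrite leNgt => /negP.
  have [V [cV Vy VA]] : exists V : set X, [/\ clopen V, V y & V `<=` ~` A].
    have oA : @open (Topological.Pack W) (~` A) by rewrite openC.
    have [V [BV Vy] VA] := bB.2 y (~` A) (open_nbhs_nbhs (conj oA nAy)).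
    exists V; split=> //; have [oV cV] := Bc V BV.
    split; first exact: Wcoarse.
    by rewrite -openC; apply: Wcoarse; rewrite openC.
  have cS : countable [set b | V b /\ agree m (x a0).1 (x b).1].
    apply: (clopen_slice x_meets (t0 := (x a0).2) cV d0) => b /VA nAb wb bd.
    by apply: nAb; apply: dA; split.
  have [n [e [e0 eV]]] := (open_boxP (xinj := xinj) V).1 cV.1 y Vy.
  have [q] := @rat_in_itvoo R ((x y).2 - e) (x y).2 ltac:(lra).
  have [r] := @rat_in_itvoo R (x y).2 ((x y).2 + e) ltac:(lra).
  rewrite !in_itv/= => /andP[yr re] /andP[qe qy].
  exists (mkseq (x y).1 n, q, r); last first.
    by split=> //; split; [exact/cyl_mkseq|rewrite /= qy].
  apply: subset_countable cS => b [[wb _] [/= /cyl_mkseq yb /andP[qb br]]].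
  split=> //; apply: eV; split; first exact: agree_sym.
  by rewrite ltr_norml; apply/andP; split; lra.
have [f fP] : {f : cantor -> X & forall c,
    agree m (x a0).1 (x (f c)).1 /\ (x (f c)).2 = (x a0).2 + 1 + kappa c}.
  apply: (@choice _ _ (fun c b => agree m (x a0).1 (x b).1 /\
    (x b).2 = (x a0).2 + 1 + kappa c)) => c; exact: point_on_slice.
apply: (@cantor_inj_uncountable _ f S) => [c c' E|c|//].
  by apply: (@kappa_inj R); apply: (addrI ((x a0).2 + 1)); rewrite -!(fP _).2 E.
have [fc1 fc2] := fP c; split=> //; rewrite fc2.
by have k0 : 0 <= kappa c :> R := kappa_ge0 c; rewrite ger0_norm; lra.
Qed.

End not_almost_zero_dimensional.

(** * Dimension and the Vietoris topology *)

(** Pulling back a base along an embedding, boundaries are mapped into boundaries,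
    again by an embedding. *)
Lemma dim_lt_embedding n (S T : topologicalType) (f : S -> T) :
  continuous f ->
  (forall p O, nbhs p O -> exists2 W, nbhs (f p) W & f @^-1` W `<=` O) ->
  dim_lt n T -> dim_lt n S.
Proof.
elim: n S T f => [|n IH] S T f fc fi.
  by move=> /= T0; rewrite -subset0 => p _; have : [set: T] (f p) by []; rewrite T0.
move=> [B bB Bdim]; exists [set f @^-1` U | U in B].
  split=> [_ [U BU <-]|p O].
    by apply: open_comp (bB.1 _ BU) => p _; exact: fc.
  move=> /fi[W /(bB.2 (f p))[U [BU Up] UW] WO]; exists (f @^-1` U).
    by split=> //; exists U.
  by move=> q /UW/WO.
move=> _ [U BU <-].
have fbd (p : boundary (f @^-1` U)) : f (val p) \in boundary U.
  apply/mem_set; have [clp nip] := set_valP p; split.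
    by move=> W /fc /clp[q [Uq Wq]]; exists (f q).
  by move=> /fc.
pose g (p : boundary (f @^-1` U)) : boundary U := 
  exist (fun q => q \in boundary U) (f (val p)) (fbd p).
apply: (IH (boundary (f @^-1` U)) (boundary U) g); last exact: Bdim.
  move=> p O [_ [[A oA <-] Ap AO]]; exists (val @^-1` (f @^-1` A)); split=> //.
    by exists (f @^-1` A) => //; apply: open_comp oA => q _; exact: fc.
  by move=> q Aq; apply: AO.
move=> p O [_ [[A oA <-] Ap AO]].
have [W] := fi _ _ (open_nbhs_nbhs (conj oA Ap)).
rewrite nbhsE => -[W' [oW' W'p] W'W] WA.
exists (val @^-1` W') => [|q W'q]; last by apply: AO; apply: WA; exact: W'W.
by exists (val @^-1` W'); split=> //; exists W'.
Qed.

Lemma nbhs_hyperspace (T : topologicalType) (F : hyperspace T) A :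
  nbhs F A <-> exists s, [/\ vietoris_index s, vietoris_base s F & vietoris_base s `<=` A].
Proof.
split.
  rewrite nbhsE => -[B [oB BF] BA].
  move: oB => [D DI E]; move: BF; rewrite -E => -[s Ds sF].
  exists s; split=> //; first exact: DI.
  by apply: subset_trans BA; rewrite -E => G sG; exists s.
move=> [s [sI sF sA]].
rewrite nbhsE; exists (vietoris_base s) => //; split=> //.
exists [set s]; first by move=> _ ->.
by rewrite bigcup_set1.
Qed.

Lemma vietoris_sub_open (T : topologicalType) (O : set T) :
  open O -> open [set F : hyperspace T | sval F `<=` O].
Proof.
move=> oO; rewrite openE => F FO; apply/nbhs_hyperspace; exists [:: O].
have OE : \bigcup_(U in [set` [:: O]]) U = O.
  apply/seteqP; split=> [p [U /=]|p Op]; first by rewrite inE => /eqP ->.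
  by exists O => //=; rewrite inE.
split.
- split=> // U; rewrite inE => /eqP ->; split=> //.
  by have [p Fp] := (svalP F).2; exists p; exact: FO.
- split; first by rewrite OE.
  by move=> U; rewrite inE => /eqP ->; have [p Fp] := (svalP F).2; exists p; split=> //; exact: FO.
- by move=> G [+ _]; rewrite OE.
Qed.

Lemma vietoris_hit_open (T : topologicalType) (O : set T) :
  open O -> open [set F : hyperspace T | sval F `&` O !=set0].
Proof.
move=> oO; rewrite openE => F [p [Fp Op]]; apply/nbhs_hyperspace; exists [:: O; setT].
split.
- split=> // U; rewrite !inE => /orP[]/eqP ->; split=> //; try by exists p.
  exact: openT.
- split; first by move=> q _; exists setT => //=; rewrite !inE eqxx orbT.
  by move=> U; rewrite !inE => /orP[]/eqP ->; exists p.
- by move=> G [_ h]; apply: h; rewrite inE eqxx.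
Qed.

Lemma vietoris_hit_clopen (T : topologicalType) (C : set T) :
  clopen C -> clopen [set F : hyperspace T | sval F `&` C !=set0].
Proof.
move=> [oC cC]; split; first exact: vietoris_hit_open.
rewrite -openC (_ : ~` _ = [set F : hyperspace T | sval F `<=` ~` C]).
  by apply: vietoris_sub_open; rewrite openC.
apply/seteqP; split=> F.
  by move=> nFC p Fp Cp; apply: nFC; exists p.
by move=> FC [p [/FC]].
Qed.

Definition singleton_hyperspace (T : topologicalType) (p : T) : hyperspace T :=
  exist _ [set p] (conj (@compact_set1 T p) (ex_intro _ p erefl)).

(** Singletons embed a space in its hyperspace. *)
Lemma dim_lt_hyperspace n (T : topologicalType) :
  dim_lt n (hyperspace T) -> dim_lt n T.
Proof.
apply: (dim_lt_embedding (f := @singleton_hyperspace T)) => p O.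
  move=> /nbhs_hyperspace[s [[s0 so] [_ sp] sO]].
  have pU : forall U, U \in s -> U p by move=> U /sp[_ [/= -> ]].
  have : nbhs p [set q | forall U, U \in s -> U q].
    elim: s {sO sp} so pU {s0} => [|U s IH] so pU; first by apply: filterE.
    have nU : nbhs p U.
      have Us : U \in U :: s by rewrite inE eqxx.
      by apply: open_nbhs_nbhs; split; [exact: (so U Us).1|exact: pU].
    have ns : nbhs p [set q | forall V, V \in s -> V q].
      by apply: IH => V Vs; [apply: so|apply: pU]; rewrite inE Vs orbT.
    by apply: filterS2 nU ns => q Uq sq V; rewrite inE => /orP[/eqP ->|/sq].
  apply: filterS => q sq; apply: sO; split=> [_ -> |U Us]; last first.
    by exists q; split=> //; exact: sq.
  case: s s0 {so sp pU} sq => // U s _ sq; exists U => /=; first by rewrite inE eqxx.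
  by apply: sq; rewrite inE eqxx.
rewrite nbhsE => -[V [oV Vp] VO].
exists [set F | sval F `<=` V]; last by move=> q qV; apply/VO/qV.
by apply: open_nbhs_nbhs; split; [exact: vietoris_sub_open|move=> _ ->].
Qed.

(** * The dimension of the hyperspace *)

Lemma pow3_le (R : realType) m n : (m <= n)%N -> 3 ^- n <= 3 ^- m :> R.
Proof.
by move=> mn; rewrite lef_pV2 ?posrE ?exprn_gt0// ler_eXn2l// ltr1n.
Qed.

Lemma pow3_gt0 (R : realType) n : 0 < 3 ^- n :> R.
Proof. by rewrite invr_gt0 exprn_gt0. Qed.

Lemma rat_in_itv_avoiding (R : realType) (a b : R) (Q : seq rat) :
  a < b -> exists q : rat, a < ratr q < b /\ q \notin Q.
Proof.
elim: Q a => [|r Q IH] a ab.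
  by have [q] := rat_in_itvoo ab; rewrite in_itv/=; exists q.
have [q [/andP[aq qb] qQ]] := IH a ab.
have [qr|qr] := eqVneq q r; last by exists q; rewrite aq qb inE negb_or qr.
have [q' [/andP[qq' q'b] q'Q]] := IH _ qb.
exists q'; rewrite q'b (lt_trans aq qq'); split=> //.
rewrite inE negb_or q'Q andbT.
by apply/eqP => E; move: qq'; rewrite E qr ltxx.
Qed.

Lemma eventually_seq (T : eqType) (P : nat -> T -> Prop) (s : seq T) :
  (forall U, U \in s -> exists N, forall k, (N <= k)%N -> P k U) ->
  exists N, forall k, (N <= k)%N -> forall U, U \in s -> P k U.
Proof.
elim: s => [|U s IH] h; first by exists 0%N.
have [|N NP] := IH; first by move=> V Vs; apply: h; rewrite inE Vs orbT.
have [|M MP] := h U; first by rewrite inE eqxx.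
exists (maxn M N) => k; rewrite geq_max => /andP[Mk Nk] V.
by rewrite inE => /orP[/eqP ->|]; [exact: MP|exact: NP].
Qed.

Section hyperspace_of_graph_space.
Context {R : realType} {J : Type} (x : J -> cantor * R).
Context (xinj : injective (fst \o x)).
Context (x_meets : forall K, box_closed K -> ~ countable (fst @` K) ->
  exists a, K (x a)).
Context (x_generic : forall a b c (q r : rat), a <> b ->
  (x a).2 = ratr q + kappa c -> (x b).2 = ratr r + kappa c ->
  countable (body c) -> body c (x a).1 -> body c (x b).1 -> False).
Local Notation X := (graph_space xinj).
Implicit Types (a b : X) (G H : hyperspace X).

(** Compactness in the form in which it is used below: a property indexed by
    levels that holds eventually, locally uniformly, holds eventually. *)
Lemma compact_eventually (K : set X) (P : nat -> X -> Prop) : compact K ->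
  (forall a, K a -> exists n e N, 0 < e /\
    forall b k, box a n e b -> (N <= k)%N -> P k b) ->
  exists N, forall k, (N <= k)%N -> forall a, K a -> P k a.
Proof.
move=> /compact_near_coveringP cK h.
have [|N _ NP] := cK nat \oo P _.
  move=> a /h[n [e [N [e0 nP]]]].
  exists (box a n e, [set k | (N <= k)%N]).
    split; last by exists N.
    by apply/nbhs_boxP; exists n, e; split.
  by move=> [b k] [/= ab Nk]; exact: nP.
by exists N => k Nk a Ka; exact: NP.
Qed.

(** [K] moved up by one is closed, and it misses the space because the first
    projection is injective. *)
Lemma compact_countable (K : set X) : compact K ->
  countable ((fst \o x) @` K).
Proof.
move=> cK.
pose S : set (cantor * R) :=
  [set p | exists a, [/\ K a, p.1 = (x a).1 & p.2 = (x a).2 + 1]].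
have Scl : box_closed S.
  move=> p nSp.
  have [|N NP] := compact_eventually (P := fun k a =>
      agree k p.1 (x a).1 -> `|(x a).2 + 1 - p.2| < 3 ^- k -> False) cK.
    move=> a Ka; have [pa|npa] := pselect (p.1 = (x a).1); last first.
      have [n nn] := agree_neq npa; exists n, 1, n; split=> // b k [ab _] nk pb _.
      by apply: nn; apply: agree_trans (agreeW nk pb) _; exact: agree_sym.
    pose e := `|(x a).2 + 1 - p.2| / 2.
    have e0 : 0 < e.
      rewrite divr_gt0// normr_gt0; apply/eqP => E; apply: nSp; exists a; split=> //.
      by lra.
    have [N Ne] := pow3_lt e0; exists 0%N, e, N; split=> // b k [_ be] Nk _.
    have := pow3_le R Nk; have := ler_distD ((x b).2 + 1) ((x a).2 + 1) p.2.
    rewrite (_ : (x a).2 + 1 - ((x b).2 + 1) = - ((x b).2 - (x a).2)); last by ring.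
    by rewrite normrN; move: Ne be; rewrite /e; lra.
  exists N, (3 ^- N); split; first exact: pow3_gt0.
  by move=> q [a [Ka -> ->]]; exact: NP.
apply: contrapT => nc; have [|c [a [Ka ca1 ca2]]] := x_meets Scl.
  apply: contra_not nc; apply: subset_countable => _ [a Ka <-] /=.
  by exists ((x a).1, (x a).2 + 1) => //; exists a.
by move: ca2; rewrite (xinj ca1); lra.
Qed.

(** The projection of [G] to the Cantor set, coded as a point of the Cantor set by
    the cylinders that it meets. *)
Definition trace G : cantor := fun m =>
  if (unpickle m : option (seq bool)) is Some s
  then `[< exists2 a, sval G a & cyl s (x a).1 >] else false.

Definition height G : R := kappa (trace G).

Lemma traceP G s : trace G (pickle s) <-> exists2 a, sval G a & cyl s (x a).1.
Proof. by rewrite /trace pickleK; split=> /asboolP. Qed.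

(** The projection of [G] is closed, so it is recovered from its trace. *)
Lemma body_trace G : body (trace G) = (fst \o x) @` sval G.
Proof.
apply/seteqP; split=> [z bz|_ [a Ga <-] n]; last first.
  by apply/traceP; exists a => //; exact/cyl_mkseq.
apply: contrapT => nz.
have [|N NP] := compact_eventually (P := fun k a => ~ agree k z (x a).1)
    (svalP G).1.
  move=> a Ga; have za : z <> (x a).1 by move=> za; apply: nz; exists a.
  have [n nn] := agree_neq za; exists n, 1, n; split=> // b k [ab _] nk zb.
  by apply: nn; apply: agree_trans (agreeW nk zb) _; exact: agree_sym.
have /traceP[a Ga /cyl_mkseq] := bz N.
by move=> /agree_sym; exact: NP.
Qed.

(** The genericity of the points applies because the projection of a compact
    set is countable. *)
Lemma rational_height_unique G a b (q r : rat) : sval G a -> sval G b ->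
  (x a).2 = ratr q + height G -> (x b).2 = ratr r + height G -> a = b.
Proof.
move=> Ga Gb Ea Eb; apply: contrapT => ab.
apply: (x_generic ab Ea Eb); rewrite body_trace; [|by exists a|by exists b].
exact: compact_countable (svalP G).1.
Qed.

Lemma trace_clopen N (w : cantor) : clopen [set G | agree N w (trace G)].
Proof.
elim: N => [|N IH].
  rewrite (_ : [set G | _] = setT); first exact: clopenT.
  by apply/seteqP; split.
have -> : [set G | agree N.+1 w (trace G)] =
    [set G | agree N w (trace G)] `&` [set G | w N = trace G N].
  apply/seteqP; split=> [G wG|G [wG wN] i].
    by split; [exact: agreeW wG|exact: wG].
  by rewrite ltnS leq_eqVlt => /orP[/eqP ->//|/wG].
apply: clopenI => //.
have tN : clopen [set G | trace G N].
  rewrite /trace; case: (unpickle N : option (seq bool)) => [s|]; last first.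
    rewrite (_ : [set G | false] = set0); first exact: clopen0.
    by apply/seteqP; split.
  have cs : clopen [set a : X | cyl s (x a).1].
    rewrite (_ : [set a : X | _] = [set a : X | agree (size s) (nth false s) (x a).1]).
      exact: clopen_cylinder.
    by apply/seteqP; split=> a sa i ilt; rewrite sa.
  rewrite (_ : [set G | _] = [set G : hyperspace X | sval G `&` [set a : X | cyl s (x a).1] !=set0]).
    exact: vietoris_hit_clopen.
  apply/seteqP; split=> G.
    by move=> /asboolP[a Ga sa]; exists a.
  by move=> [a [Ga sa]]; apply/asboolP; exists a.
case wN : (w N).
  rewrite (_ : [set G | _] = [set G | trace G N]) //.
  by apply/seteqP; split=> G /=; case: (trace G N).
rewrite (_ : [set G | _] = ~` [set G | trace G N]); first exact: clopenC set0 tN.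
by apply/seteqP; split=> G /=; case: (trace G N) => // h; case: (h isT).
Qed.

Lemma height_agree N G H : agree N (trace G) (trace H) ->
  `|height G - height H| < 3 ^- N.
Proof. exact: kappa_agree. Qed.

(** The basic neighbourhoods in the hyperspace. Measuring vertical positions from
    [height G] is the point of the definition: at most one
    point of [G] has a rational position relative to it. *)
Definition strip n N (w : cantor) (lo hi : seq bool -> rat) : set (hyperspace X) :=
  [set G | agree N w (trace G) /\ forall a, sval G a ->
    ratr (lo (mkseq (x a).1 n)) + height G < (x a).2 <
    ratr (hi (mkseq (x a).1 n)) + height G].

Definition strip_heights n (lo hi : seq bool -> rat) : seq rat :=
  [seq lo (tval s) | s <- enum {: n.-tuple bool}] ++
  [seq hi (tval s) | s <- enum {: n.-tuple bool}].

Lemma mkseq_agree n (z w : cantor) : agree n z w -> mkseq z n = mkseq w n.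
Proof. by move=> zw; apply/eq_in_map => i; rewrite mem_iota => /andP[_]; exact: zw. Qed.

Lemma strip_open n N w lo hi : open (strip n N w lo hi).
Proof.
rewrite openE => G [wG GU].
have [|k kP] := compact_eventually (P := fun k a =>
    ratr (lo (mkseq (x a).1 n)) + height G + 3 ^- k < (x a).2 <
    ratr (hi (mkseq (x a).1 n)) + height G - 3 ^- k) (svalP G).1.
  move=> a /GU /andP[la ha].
  pose e := Num.min ((x a).2 - (ratr (lo (mkseq (x a).1 n)) + height G))
    (ratr (hi (mkseq (x a).1 n)) + height G - (x a).2) / 2.
  have e0 : 0 < e by rewrite divr_gt0// lt_min !subr_gt0 la.
  have [M Me] := pow3_lt e0; exists n, e, M; split=> // b k [ab].
  rewrite -(mkseq_agree ab) => be Mk.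
  have := pow3_le R Mk; move: be.
  have : 2 * e <= (x a).2 - (ratr (lo (mkseq (x a).1 n)) + height G).
    by rewrite /e mulrCA divff// mulr1 ge_min lexx.
  have : 2 * e <= ratr (hi (mkseq (x a).1 n)) + height G - (x a).2.
    by rewrite /e mulrCA divff// mulr1 ge_min lexx orbT.
  rewrite ltr_norml => h1 h2 /andP[h3 h4] h5.
  by apply/andP; split; lra.
pose U := [set a : X | ratr (lo (mkseq (x a).1 n)) + height G + 3 ^- k < (x a).2 <
    ratr (hi (mkseq (x a).1 n)) + height G - 3 ^- k].
have oU : open U.
  apply/open_boxP => a /andP[la ha].
  exists n, (Num.min ((x a).2 - (ratr (lo (mkseq (x a).1 n)) + height G + 3 ^- k))
    (ratr (hi (mkseq (x a).1 n)) + height G - 3 ^- k - (x a).2)).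
  split; first by rewrite lt_min !subr_gt0 la.
  move=> b [/mkseq_agree ab]; rewrite lt_min !ltr_norml => /andP[/andP[h1 h2] /andP[h3 h4]].
  by rewrite /U /= -ab; apply/andP; split; lra.
have := open_nbhs_nbhs (conj (trace_clopen (maxn N k) (trace G)).1 (@agreexx _ (trace G))).
have : nbhs G [set H | sval H `<=` U].
  by apply: open_nbhs_nbhs; split; [exact: vietoris_sub_open|move=> a; exact: kP].
apply: filterS2 => H HU GH; split.
  by apply: (agree_trans wG); exact: agreeW (leq_maxl _ _) GH.
move=> a /HU /andP[la ha].
have := height_agree (agreeW (leq_maxr N k) GH); rewrite ltr_norml => /andP[? ?].
by apply/andP; split; lra.
Qed.

(** If no bound is attained, then either all of them hold strictly, and [G] is in
    the open set, or one of them is violated, and remains so nearby. *)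
Lemma strip_boundary n N w lo hi G : boundary (strip n N w lo hi) G ->
  exists a q, [/\ sval G a, q \in strip_heights n lo hi &
    (x a).2 = ratr q + height G].
Proof.
move=> [clG niG].
have niG' : ~ strip n N w lo hi G.
  have <- // : (strip n N w lo hi)° = strip n N w lo hi.
  by apply/interior_id; exact: strip_open.
have wG : agree N w (trace G).
  by apply: (trace_clopen N w).2; apply: closure_subset clG => H [].
have [a [Ga out]] : exists a, sval G a /\
    ~ (ratr (lo (mkseq (x a).1 n)) + height G < (x a).2 <
       ratr (hi (mkseq (x a).1 n)) + height G).
  apply: contrapT => h; apply: niG'; split=> // a Ga.
  by apply: contrapT => h'; apply: h; exists a.
set l := ratr (lo _) in out; set h := ratr (hi _) in out.
have near_a e : 0 < e -> exists H b, [/\ strip n N w lo hi H, sval H b,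
    agree n (x a).1 (x b).1, `|(x b).2 - (x a).2| < e & `|height G - height H| < e].
  move=> e0; have [M Me] := pow3_lt e0.
  have nt := open_nbhs_nbhs (conj (trace_clopen M (trace G)).1 (@agreexx _ (trace G))).
  have nh : nbhs G [set H | sval H `&` box a n e !=set0].
    apply: open_nbhs_nbhs; split; first by apply: vietoris_hit_open; exact: box_open.
    by exists a; split=> //; exact: box_center.
  have [H [sH [/= GH [b [Hb [ab be]]]]]] := clG _ (filterI nt nh).
  by exists H, b; split=> //; apply: lt_trans Me; exact: height_agree.
have le1 : l + height G <= (x a).2.
  rewrite leNgt; apply/negP => lt.
  have e0 : 0 < (l + height G - (x a).2) / 2 by rewrite divr_gt0// subr_gt0.
  have [H [b [[_ /(_ b)sH] Hb ab]]] := near_a _ e0.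
  rewrite !ltr_norml => /andP[h1 h2] /andP[h3 h4].
  have /andP[+ _] := sH Hb; rewrite -(mkseq_agree ab) -/l; lra.
have le2 : (x a).2 <= h + height G.
  rewrite leNgt; apply/negP => lt.
  have e0 : 0 < ((x a).2 - (h + height G)) / 2 by rewrite divr_gt0// subr_gt0.
  have [H [b [[_ /(_ b)sH] Hb ab]]] := near_a _ e0.
  rewrite !ltr_norml => /andP[h1 h2] /andP[h3 h4].
  have /andP[_ +] := sH Hb; rewrite -(mkseq_agree ab) -/h; lra.
have szn : size (mkseq (x a).1 n) == n by rewrite size_mkseq.
have [lt1|ge1] := ltP (l + height G) (x a).2.
  have [lt2|ge2] := ltP (x a).2 (h + height G).
    by case: out; rewrite lt1 lt2.
  exists a, (hi (mkseq (x a).1 n)); split=> //; last first.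
    by apply/eqP; rewrite eq_le le2 ge2.
  rewrite mem_cat; apply/orP; right; apply/mapP.
  by exists (Tuple szn) => //; rewrite mem_enum.
exists a, (lo (mkseq (x a).1 n)); split=> //; last first.
  by apply/eqP; rewrite eq_le le1 ge1.
rewrite mem_cat; apply/orP; left; apply/mapP.
by exists (Tuple szn) => //; rewrite mem_enum.
Qed.

(** A strip around [G] of small vertical size over cylinders of a high level is
    small in the Vietoris topology, because the vertical coordinate is uniformly
    continuous on [G]. Its rational bounds can be moved a little, hence
    chosen outside a finite set [Q]. *)
Lemma strip_base (Q : seq rat) G (O : set (hyperspace X)) : nbhs G O ->
  exists n N w lo hi, [/\ strip n N w lo hi G, strip n N w lo hi `<=` O &
    forall q, q \in strip_heights n lo hi -> q \notin Q].
Proof.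
move=> /nbhs_hyperspace[s [[_ so] [Gs Gm] sO]].
have cG := (svalP G).1.
have shrink a (U : set X) : open U -> U a -> exists n e N, 0 < e /\
    forall b k, box a n e b -> (N <= k)%N -> box b k (3 ^- k) `<=` U.
  move=> oU Ua; have [n [e [e0 eU]]] := (open_boxP U).1 oU a Ua.
  have e20 : 0 < e / 2 by rewrite divr_gt0.
  have [M Me] := pow3_lt e20; exists n, (e / 2), (maxn n M); split=> //.
  move=> b k [ab be]; rewrite geq_max => /andP[nk Mk] c [bc ce]; apply: eU.
  split; first by apply: (agree_trans ab); exact: agreeW nk bc.
  have := ler_distD (x b).2 (x c).2 (x a).2; have := pow3_le R Mk; lra.
have [|N1 N1P] := compact_eventually (P := fun k a =>
    exists2 U, U \in s & box a k (3 ^- k) `<=` U) cG.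
  move=> a /Gs[U Us Ua]; have [n [e [N [e0 sh]]]] := shrink a U (so U Us).1 Ua.
  by exists n, e, N; split=> // b k ab Nk; exists U => //; exact: sh.
have [|N2 N2P] := eventually_seq (s := s) (P := fun k U =>
    exists2 a, sval G a & box a k (3 ^- k) `<=` U).
  move=> U Us; have [a [Ga Ua]] := Gm U Us.
  have [n [e [N [e0 sh]]]] := shrink a U (so U Us).1 Ua.
  exists N => k Nk; exists a => //; apply: sh => //; exact: box_center.
(* At level [k], boxes of radius [e] around points of [G] lie in members of [s],
   and each member of [s] contains such a box. *)
pose k := maxn N1 N2; pose e : R := 3 ^- k.
have e0 : 0 < e := pow3_gt0 R k.
have e80 : 0 < e / 8 by rewrite divr_gt0.
have [|N3 N3P] := compact_eventually (P := fun j a => forall b, sval G b ->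
    agree j (x a).1 (x b).1 -> `|(x b).2 - (x a).2| < e / 8) cG.
  move=> a Ga.
  have [|M MP] := compact_eventually (P := fun j b =>
      agree j (x a).1 (x b).1 -> `|(x b).2 - (x a).2| < e / 16) cG.
    move=> b Gb; have [ab|nab] := pselect (a = b).
      rewrite -ab; exists 0%N, (e / 16), 0%N; split; first by rewrite divr_gt0.
      by move=> c j [].
    have [n nn] : exists n, ~ agree n (x a).1 (x b).1.
      by apply: agree_neq => /xinj.
    exists n, 1, n; split=> // c j [bc _] nj ac; case: nn.
    by apply: (agree_trans (agreeW nj ac)); exact: agree_sym.
  exists M, (e / 16), M; split; first by rewrite divr_gt0.
  move=> b j [ab be] Mj c Gc bc.
  have ac := MP M (leqnn M) c Gc (agree_trans ab (agreeW Mj bc)).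
  have := ler_distD (x a).2 (x c).2 (x b).2; rewrite (distrC (x a).2).
  by lra.
pose n := maxn k N3.
have osc a b : sval G a -> sval G b -> agree n (x a).1 (x b).1 ->
    `|(x b).2 - (x a).2| < e / 8.
  by move=> Ga Gb ab; apply: (N3P N3) => //; exact: agreeW (leq_maxr _ _) ab.
(* The bounds over a cylinder are taken at distance between [e / 8] and [e / 4]
   from the position of one point of [G]; those of the other points of [G] in
   the cylinder differ by less than [e / 8]. *)
have [bd bdP] : {bd : seq bool -> rat * rat & forall s,
    [/\ (bd s).1 \notin Q, (bd s).2 \notin Q & forall a, sval G a -> mkseq (x a).1 n = s ->
      [/\ (x a).2 - e * 3 / 8 < ratr (bd s).1 + height G,
          ratr (bd s).1 + height G < (x a).2,
          (x a).2 < ratr (bd s).2 + height G &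
          ratr (bd s).2 + height G < (x a).2 + e * 3 / 8]]}.
  apply: (@choice _ _ (fun s (p : rat * rat) => [/\ p.1 \notin Q, p.2 \notin Q &
      forall a, sval G a -> mkseq (x a).1 n = s ->
      [/\ (x a).2 - e * 3 / 8 < ratr p.1 + height G,
          ratr p.1 + height G < (x a).2,
          (x a).2 < ratr p.2 + height G &
          ratr p.2 + height G < (x a).2 + e * 3 / 8]])) => s'.
  have [[a [Ga as']]|no] := pselect (exists a, sval G a /\ mkseq (x a).1 n = s').
    have [q [/andP[q1 q2] qQ]] := @rat_in_itv_avoiding R
      ((x a).2 - height G - e / 4) ((x a).2 - height G - e / 8) Q ltac:(lra).
    have [r [/andP[r1 r2] rQ]] := @rat_in_itv_avoiding R
      ((x a).2 - height G + e / 8) ((x a).2 - height G + e / 4) Q ltac:(lra).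
    exists (q, r); split=> // b Gb bs' /=.
    have ab : agree n (x a).1 (x b).1.
      by apply/agree_sym/cyl_mkseq; rewrite as' -bs'; exact/cyl_mkseq.
    have := osc a b Ga Gb ab; rewrite ltr_norml => /andP[h1 h2].
    by split; lra.
  have [q [_ qQ]] := @rat_in_itv_avoiding R 0 1 Q ltr01.
  by exists (q, q); split=> // a Ga as'; case: no; exists a.
have [M Me] := pow3_lt e80.
(* The first [N] digits of the trace decide which cylinders of level [n] are met,
   and determine the height up to [e / 8]. *)
pose N := maxn M (\max_(s' : n.-tuple bool) (pickle (tval s')).+1).
exists n, N, (trace G), (fun s => (bd s).1), (fun s => (bd s).2); split; last first.
- move=> q; rewrite mem_cat => /orP[] /mapP[s' _ ->].
    by have [] := bdP s'.
  by have [] := bdP s'.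
- move=> H [GH HU]; apply: sO.
  have code_lt (z : cantor) : (pickle (mkseq z n) < N)%N.
    have szn : size (mkseq z n) == n by rewrite size_mkseq.
    apply: leq_trans (leq_maxr _ _).
    exact: (@leq_bigmax _ (fun s' : n.-tuple bool => (pickle (tval s')).+1) (Tuple szn)).
  have hGH := height_agree (agreeW (leq_maxl _ _) GH : agree M _ _).
  have close a b : sval G a -> sval H b -> agree n (x a).1 (x b).1 ->
      box a k e b.
    move=> Ga Hb ab; split; first exact: agreeW (leq_maxl _ _) ab.
    have [_ _ /(_ a Ga erefl)[h1 h2 h3 h4]] := bdP (mkseq (x a).1 n).
    have /andP[] := HU b Hb; rewrite -(mkseq_agree ab) => h5 h6.
    move: hGH; rewrite ltr_norml => /andP[h7 h8].
    by rewrite ltr_norml; apply/andP; split; lra.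
  split.
    move=> b Hb.
    have /traceP[a Ga /cyl_mkseq ab] : trace G (pickle (mkseq (x b).1 n)).
      by rewrite GH//; apply/traceP; exists b => //; exact/cyl_mkseq.
    have [U Us aU] := N1P k (leq_maxl _ _) a Ga.
    by exists U => //; apply: aU; exact: close.
  move=> U Us; have [a Ga aU] := N2P k (leq_maxr _ _) U Us.
  have /traceP[b Hb /cyl_mkseq ba] : trace H (pickle (mkseq (x a).1 n)).
    by rewrite -GH//; apply/traceP; exists a => //; exact/cyl_mkseq.
  by exists b; split=> //; apply: aU; apply: close => //; exact: agree_sym.
- split=> // a Ga; have [_ _ /(_ a Ga erefl)[_ h1 h2 _]] := bdP (mkseq (x a).1 n).
  by rewrite h1 h2.
Qed.

(** A compact set in the boundaries of two strips has a point at a rational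
    relative height taken from each of them; this is the same point, so the two
    strips share a rational. *)
Lemma hyperspace_dim_lt2 : dim_lt 2 (hyperspace X).
Proof.
apply: (@dim_lt2_disjoint_boundaries _
  [set U | exists n N w lo hi, U = strip n N w lo hi]).
- by move=> _ [n [N [w [lo [hi ->]]]]]; exact: strip_open.
- move=> G O /(strip_base [::])[n [N [w [lo [hi [sG sO _]]]]]].
  by exists (strip n N w lo hi); split=> //; exists n, N, w, lo, hi.
- move=> _ G O [n [N [w [lo [hi ->]]]]].
  move=> /(strip_base (strip_heights n lo hi))[n' [N' [w' [lo' [hi' [sG sO new]]]]]].
  exists (strip n' N' w' lo' hi'); split=> //; first by exists n', N', w', lo', hi'.
  rewrite -subset0 => H [/strip_boundary[a [q [Ha qQ Ea]]]].
  move=> /strip_boundary[b [r [Hb rQ Eb]]].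
  have ab := rational_height_unique Ha Hb Ea Eb.
  have qr : q = r.
    apply: (fmorph_inj (ratr : rat -> R)); apply: (addIr (height H)).
    by rewrite -Ea -Eb ab.
  by have := new q qQ; rewrite qr rQ.
Qed.

End hyperspace_of_graph_space.

Theorem theorem1p2 (R : realType) :
  exists X : metricType R,
    [/\ separable X,
        totally_disconnected_space X,
        ~ almost_zero_dimensional X,
        has_dim 1 X &
        has_dim 1 (hyperspace X)].
Proof.
have [J [x [xinj x_meets x_generic]]] := @generic_set R.
have nX1 : ~ dim_lt 1 (graph_space xinj).
  move=> /dim_lt1P/clopen_base_almost_zero_dimensional.
  exact: graph_space_not_almost_zero_dimensional.
have KX2 := hyperspace_dim_lt2 xinj x_meets x_generic.
exists (graph_space xinj); split.
- exact: graph_space_separable.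
- exact: graph_space_totally_disconnected.
- exact: graph_space_not_almost_zero_dimensional.
- by split=> //; exact: dim_lt_hyperspace KX2.
- by split=> // /dim_lt_hyperspace.
Qed.
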